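(* Let $\mathcal{A}$ be a semi-abelian category and $\mathcal{E}$ a class of extensions in $\mathcal{A}$. Suppose $n\geq 1$. For any $0\leq i\leq n-1$ and any $n$-fold arrow $A$ in $\mathcal{A}$, the following properties are equivalent: (1) $A$ is an $n$-fold $\mathcal{E}$-extension (in $\mathcal{A}$); (2) $\rho_iA$ is an $(n-1)$-fold $\mathcal{E}^1$-extension (in $\mathsf{Arr}\,\mathcal{A}$).
   Context: Semi-abelian means pointed, finitely complete and cocomplete, Barr-exact and Bourn-protomodular. For a class $\mathcal{E}$ of morphisms in $\mathcal{A}$, $\mathcal{E}^-$ is the class of objects that are the domain or the codomain of at least one arrow in $\mathcal{E}$. Class of extensions. A class $\mathcal{E}$ of regular epimorphisms in $\mathcal{A}$ with $0\in\mathcal{E}^-$ is a class of extensions (its members are called ($\mathcal{E}$-)extensions) if: (1) $\mathcal{E}$ contains all split epimorphisms $f\colon A\to B$ with $A,B\in\mathcal{E}^-$; (2) for composable $f\colon A\to B$, $g\colon B\to C$: if $f,g\in\mathcal{E}$ then $g\circ f\in\mathcal{E}$, and if $g\circ f\in\mathcal{E}$ and $B\in\mathcal{E}^-$ then $g\in\mathcal{E}$; (3) for $f\colon A\to B$ in $\mathcal{E}$ and $g\colon C\to B$ in $\mathcal{A}$ with $C\in\mathcal{E}^-$, the pullback $g^*f\colon C\times_B A\to C$ is in $\mathcal{E}$; (4) if $0\to K\to A\xrightarrow{f} B\to 0$ is short exact with $A\in\mathcal{E}^-$ and $K\in\mathcal{E}^-$, then $f\in\mathcal{E}$; (5) for every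 morphism of short exact sequences from $0\to K\to A\xrightarrow{f}B\to 0$ to $0\to L\to C\xrightarrow{g}B\to 0$ with components $k\colon K\to L$, $a\colon A\to C$, $1_B$: if $f,k\in\mathcal{E}$ and $C\in\mathcal{E}^-$, then $a\in\mathcal{E}$. Double extensions. $\mathsf{Arr}\,\mathcal{A}$ is the category of arrows of $\mathcal{A}$, with commutative squares as morphisms. A morphism $(f_1,f_0)\colon a\to b$ from $a\colon A_1\to A_0$ to $b\colon B_1\to B_0$ (with $f_1\colon A_1\to B_1$, $f_0\colon A_0\to B_0$) is a double $\mathcal{E}$-extension if $a,b,f_0,f_1$, the two projections of the pullback $A_0\times_{B_0}B_1$, and the induced arrow $A_1\to A_0\times_{B_0}B_1$ are all in $\mathcal{E}$. $\mathcal{E}^1$ is the class of double $\mathcal{E}$-extensions; it is a class of extensions in the semi-abelian category $\mathsf{Arr}\,\mathcal{A}$. Higher extensions. Put $0=\varnothing$, $n=\{0,\dots,n-1\}$. An $n$-fold arrow in $\mathcal{A}$ is a functor $A\colon\mathcal{P}(n)^{\mathrm{op}}\to\mathcal{A}$ ($\mathcal{P}(n)$ the powerset ordered by inclusion); $\mathsf{Arr}^n\mathcal{A}$ is the (semi-abelian) category of $n$-fold arrows and natural transformations. Write $A_S=A(S)$ and $a_S^T\colon A_T\to A_S$ for $S\subseteq T$. The isomorphism $\delta_{n-1}\colon \mathsf{Arr}^n\mathcal{A}\to\mathsf{Arr}(\mathsf{Arr}^{n-1}\mathcal{A})$ sends $A$ to $(a_S^{S\cup\{n-1\}})_{S\subseteq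 n-1}\colon (A_{S\cup\{n-1\}})_{S\subseteq n-1}\to(A_S)_{S\subseteq n-1}$. Put $\mathcal{E}^0=\mathcal{E}$ and, inductively for $n\geq1$, let $\mathcal{E}^n$ be the class of arrows $f\colon A\to B$ in $\mathsf{Arr}^n\mathcal{A}$ whose induced square $\delta_{n-1}A\to\delta_{n-1}B$ in $\mathsf{Arr}^{n-1}\mathcal{A}$ is a double $\mathcal{E}^{n-1}$-extension; $\mathcal{E}^n$ is a class of extensions in $\mathsf{Arr}^n\mathcal{A}$. For $n\geq 1$ an $n$-fold $\mathcal{E}$-extension is an $n$-fold arrow $A$ with $\delta_{n-1}A\in\mathcal{E}^{n-1}$; a $0$-fold $\mathcal{E}$-extension is an object of $\mathcal{E}^-$. The same definitions apply to any semi-abelian category with a class of extensions, in particular to $(\mathsf{Arr}\,\mathcal{A},\mathcal{E}^1)$. The functors $\rho_i$. For $i\geq0$ let $s_i\colon\mathbb{N}\to\mathbb{N}$ be $s_i(k)=k$ if $k<i$ and $s_i(k)=k+1$ if $k\geq i$; for $S\subseteq\mathbb{N}$ put $S^i=s_i(S)$. For $n\ge1$, $0\leq i\leq n-1$, and an $n$-fold arrow $A$ in $\mathcal{A}$, $\rho_iA$ is the $(n-1)$-fold arrow in $\mathsf{Arr}\,\mathcal{A}$ given by $\bigl(a_{S^i}^{S^i\cup\{i\}}\colon A_{S^i\cup\{i\}}\to A_{S^i}\bigr)_{S\subseteq n-1}$. *)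

(* Defs.v *)
From mathcomp Require Import all_boot.
From Stdlib Require List.
From Stdlib Require Import FunctionalExtensionality ProofIrrelevance.

Set Implicit Arguments.
Unset Strict Implicit.
Unset Printing Implicit Defensive.

#[local] Obligation Tactic := idtac.

Declare Scope cat_scope.
Delimit Scope cat_scope with cat.
Local Open Scope cat_scope.

Record Category := {
  Ob :> Type;
  Hom : Ob -> Ob -> Type;
  idm : forall X, Hom X X;
  comp : forall X Y Z, Hom Y Z -> Hom X Y -> Hom X Z;
  comp_idl : forall X Y (f : Hom X Y), comp (idm Y) f = f;
  comp_idr : forall X Y (f : Hom X Y), comp f (idm X) = f;
  compA : forall X Y Z W (h : Hom Z W) (g : Hom Y Z) (f : Hom X Y),
    comp h (comp g f) = comp (comp h g) f
}.
Arguments Hom {c} X Y.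
Arguments idm {c} X.
Arguments comp {c X Y Z} g f.
Notation "g ∘ f" := (comp g f) (at level 40, left associativity) : cat_scope.

Definition op (C : Category) : Category := {|
  Ob := C;
  Hom := fun X Y => @Hom C Y X;
  idm := fun X => @idm C X;
  comp := fun X Y Z g f => @comp C Z Y X f g;
  comp_idl := fun X Y f => comp_idr f;
  comp_idr := fun X Y f => comp_idl f;
  compA := fun X Y Z W h g f => esym (compA f g h)
|}.

Record Functor (J C : Category) := {
  fobj :> J -> C;
  fmap : forall X Y, Hom X Y -> Hom (fobj X) (fobj Y);
  fmap_id : forall X, fmap (idm X) = idm (fobj X);
  fmap_comp : forall X Y Z (g : Hom Y Z) (f : Hom X Y),
    fmap (g ∘ f) = fmap g ∘ fmap f
}.
Arguments fmap {J C} F {X Y} f : rename.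

Record NatTrans (J C : Category) (F G : Functor J C) := {
  ntc :> forall X : J, Hom (F X) (G X);
  nt_nat : forall X Y (f : Hom X Y), ntc Y ∘ fmap F f = fmap G f ∘ ntc X
}.

Lemma nt_ext (J C : Category) (F G : Functor J C) (s t : NatTrans F G) :
  (forall X, s X = t X) -> s = t.
Proof.
case: s t => [s Hs] [t Ht] /= e.
have {}e : s = t by apply: functional_extensionality_dep.
by subst t; rewrite (proof_irrelevance _ Hs Ht).
Qed.

Section FunctorCategory.
Variables J C : Category.

Program Definition nt_id (F : Functor J C) : NatTrans F F :=
  {| ntc := fun X => idm (F X) |}.
Next Obligation. by move=> F X Y f; rewrite comp_idl comp_idr. Qed.

Program Definition nt_comp (F G H : Functor J C)
    (t : NatTrans G H) (s : NatTrans F G) : NatTrans F H :=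
  {| ntc := fun X => t X ∘ s X |}.
Next Obligation.
by move=> F G H t s X Y f; rewrite -compA nt_nat compA nt_nat compA.
Qed.

Program Definition Fun : Category :=
  {| Ob := Functor J C; Hom := @NatTrans J C; idm := nt_id; comp := nt_comp |}.
Next Obligation. by move=> F G s; apply: nt_ext => X /=; rewrite comp_idl. Qed.
Next Obligation. by move=> F G s; apply: nt_ext => X /=; rewrite comp_idr. Qed.
Next Obligation. by move=> F G H K u t s; apply: nt_ext => X /=; rewrite compA. Qed.
End FunctorCategory.

Record ArrOb (C : Category) := MkArr {
  adom : C;
  acod : C;
  arr :> Hom adom acod
}.

Record ArrHom (C : Category) (a b : ArrOb C) := MkArrHom {
  hdom : Hom (adom a) (adom b);
  hcod : Hom (acod a) (acod b);
  hcomm : b ∘ hdom = hcod ∘ a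
}.

Lemma arrhom_ext (C : Category) (a b : ArrOb C) (f g : ArrHom a b) :
  hdom f = hdom g -> hcod f = hcod g -> f = g.
Proof.
case: f g => [f1 f0 Hf] [g1 g0 Hg] /= e1 e0; subst g1 g0.
by rewrite (proof_irrelevance _ Hf Hg).
Qed.

Section ArrowCategory.
Variable C : Category.

Program Definition arr_id (a : ArrOb C) : ArrHom a a :=
  {| hdom := idm _; hcod := idm _ |}.
Next Obligation. by move=> a; rewrite comp_idl comp_idr. Qed.

Program Definition arr_comp (a b c : ArrOb C) (g : ArrHom b c) (f : ArrHom a b) :
  ArrHom a c := {| hdom := hdom g ∘ hdom f; hcod := hcod g ∘ hcod f |}.
Next Obligation. by move=> a b c g f; rewrite compA hcomm -compA hcomm compA. Qed.

Program Definition Arr : Category :=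
  {| Ob := ArrOb C; Hom := @ArrHom C; idm := arr_id; comp := arr_comp |}.
Next Obligation. by move=> a b f; apply: arrhom_ext; rewrite /= comp_idl. Qed.
Next Obligation. by move=> a b f; apply: arrhom_ext; rewrite /= comp_idr. Qed.
Next Obligation. by move=> a b c d h g f; apply: arrhom_ext; rewrite /= compA. Qed.
End ArrowCategory.

Section Notions.
Variable C : Category.

Definition IsIso (X Y : C) (f : Hom X Y) : Prop :=
  exists g : Hom Y X, g ∘ f = idm X /\ f ∘ g = idm Y.

Definition IsSplitEpi (X Y : C) (f : Hom X Y) : Prop :=
  exists s : Hom Y X, f ∘ s = idm Y.

Definition IsZero (Z : C) : Prop :=
  (forall X : C, exists! f : Hom Z X, True) /\
  (forall X : C, exists! f : Hom X Z, True).

Definition IsZeroMor (X Y : C) (f : Hom X Y) : Prop :=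
  exists (Z : C) (g : Hom X Z) (h : Hom Z Y), IsZero Z /\ f = h ∘ g.

(** The square [f ∘ p = g ∘ q] is a pullback of [f] and [g]. *)
Definition IsPullback (X Y B P : C) (f : Hom X B) (g : Hom Y B)
    (p : Hom P X) (q : Hom P Y) : Prop :=
  f ∘ p = g ∘ q /\
  forall (T : C) (x : Hom T X) (y : Hom T Y), f ∘ x = g ∘ y ->
    exists! u : Hom T P, p ∘ u = x /\ q ∘ u = y.

Definition IsCoequalizer (R X Q : C) (r1 r2 : Hom R X) (f : Hom X Q) : Prop :=
  f ∘ r1 = f ∘ r2 /\
  forall (T : C) (h : Hom X T), h ∘ r1 = h ∘ r2 ->
    exists! u : Hom Q T, u ∘ f = h.

Definition IsRegularEpi (X Y : C) (f : Hom X Y) : Prop :=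
  exists (R : C) (r1 r2 : Hom R X), IsCoequalizer r1 r2 f.

Definition IsKernelPair (X Y R : C) (f : Hom X Y) (r1 r2 : Hom R X) : Prop :=
  IsPullback f f r1 r2.

Definition IsKernel (K X Y : C) (k : Hom K X) (f : Hom X Y) : Prop :=
  IsZeroMor (f ∘ k) /\
  forall (T : C) (h : Hom T X), IsZeroMor (f ∘ h) ->
    exists! u : Hom T K, k ∘ u = h.

Definition IsCokernel (K X Y : C) (k : Hom K X) (f : Hom X Y) : Prop :=
  IsZeroMor (f ∘ k) /\
  forall (T : C) (h : Hom X T), IsZeroMor (h ∘ k) ->
    exists! u : Hom Y T, u ∘ f = h.

Definition ShortExact (K X Y : C) (k : Hom K X) (f : Hom X Y) : Prop :=
  IsKernel k f /\ IsCokernel k f.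

Definition IsEquivalenceRelation (R X : C) (r1 r2 : Hom R X) : Prop :=
  [/\ forall (T : C) (u v : Hom T R),
        r1 ∘ u = r1 ∘ v -> r2 ∘ u = r2 ∘ v -> u = v,
      exists e : Hom X R, r1 ∘ e = idm X /\ r2 ∘ e = idm X,
      exists s : Hom R R, r1 ∘ s = r2 /\ r2 ∘ s = r1
    & forall (P : C) (p q : Hom P R), IsPullback r2 r1 p q ->
        exists t : Hom P R, r1 ∘ t = r1 ∘ p /\ r2 ∘ t = r2 ∘ q].
End Notions.

Definition FiniteCategory (J : Category) : Prop :=
  (exists s : seq J, forall x : J, List.In x s) /\
  (forall x y : J, exists s : seq (Hom x y), forall f, List.In f s).

Definition IsCone (J C : Category) (F : Functor J C) (L : C)
    (c : forall j : J, Hom L (F j)) : Prop :=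
  forall (j k : J) (h : Hom j k), fmap F h ∘ c j = c k.

Definition IsLimit (J C : Category) (F : Functor J C) (L : C)
    (c : forall j : J, Hom L (F j)) : Prop :=
  IsCone c /\
  forall (T : C) (d : forall j : J, Hom T (F j)), IsCone d ->
    exists! u : Hom T L, forall j, c j ∘ u = d j.

Definition FinitelyComplete (C : Category) : Prop :=
  forall (J : Category) (F : Functor J C), FiniteCategory J ->
    exists (L : C) (c : forall j : J, Hom L (F j)), IsLimit c.

(** Every functor [J -> C] is a functor [op J -> op C], so this says that [C]
    has all finite colimits. *)
Definition FinitelyCocomplete (C : Category) : Prop := FinitelyComplete (op C).

Definition Pointed (C : Category) : Prop := exists Z : C, IsZero Z.

Definition Regular (C : Category) : Prop :=
  [/\ FinitelyComplete C,
      forall (X Y R : C) (f : Hom X Y) (r1 r2 : Hom R X),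
        IsKernelPair f r1 r2 ->
        exists (Q : C) (q : Hom X Q), IsCoequalizer r1 r2 q
    & forall (X Y B P : C) (f : Hom X B) (g : Hom Y B)
        (p : Hom P X) (q : Hom P Y),
        IsPullback f g p q -> IsRegularEpi f -> IsRegularEpi q].

Definition BarrExact (C : Category) : Prop :=
  Regular C /\
  forall (R X : C) (r1 r2 : Hom R X), IsEquivalenceRelation r1 r2 ->
    exists (Y : C) (f : Hom X Y), IsKernelPair f r1 r2.

(** For every [v : D -> B], the pullback functor [v^*] from points over [B]
    (split epimorphisms with a chosen section) to points over [D] reflects
    isomorphisms: [f] is a morphism of points over [B] and [g] is its image under
    [v^*]. No hypothesis on the sections of the pulled-back points is needed, as
    [g] automatically commutes with the induced ones; and a morphism of points is
    invertible as soon as the underlying morphism is. *)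
Definition BournProtomodular (C : Category) : Prop :=
  forall (D B X X' : C) (v : Hom D B)
    (p : Hom X B) (s : Hom B X) (p' : Hom X' B) (s' : Hom B X')
    (f : Hom X X')
    (P P' : C) (pX : Hom P X) (pD : Hom P D) (pX' : Hom P' X') (pD' : Hom P' D)
    (g : Hom P P'),
    p ∘ s = idm B -> p' ∘ s' = idm B ->
    p' ∘ f = p -> f ∘ s = s' ->
    IsPullback p v pX pD -> IsPullback p' v pX' pD' ->
    pX' ∘ g = f ∘ pX -> pD' ∘ g = pD ->
    IsIso g -> IsIso f.

Definition SemiAbelian (C : Category) : Prop :=
  [/\ Pointed C, FinitelyComplete C, FinitelyCocomplete C,
      BarrExact C & BournProtomodular C].

Definition MorClass (C : Category) := forall X Y : C, Hom X Y -> Prop.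

(** The class written [E^-]. *)
Definition ExtOb (C : Category) (E : MorClass C) (X : C) : Prop :=
  (exists (Y : C) (f : Hom X Y), E X Y f) \/
  (exists (Y : C) (f : Hom Y X), E Y X f).

Record ClassOfExtensions (C : Category) (E : MorClass C) : Prop := {
  ext_regular_epi : forall (X Y : C) (f : Hom X Y), E _ _ f -> IsRegularEpi f;
  ext_zero : forall Z : C, IsZero Z -> ExtOb E Z;
  ext_split_epi : forall (X Y : C) (f : Hom X Y),
    ExtOb E X -> ExtOb E Y -> IsSplitEpi f -> E _ _ f;
  ext_comp : forall (X Y Z : C) (f : Hom X Y) (g : Hom Y Z),
    E _ _ f -> E _ _ g -> E _ _ (g ∘ f);
  ext_cancel : forall (X Y Z : C) (f : Hom X Y) (g : Hom Y Z),
    E _ _ (g ∘ f) -> ExtOb E Y -> E _ _ g;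
  ext_pullback : forall (X B Y P : C) (f : Hom X B) (g : Hom Y B)
      (p : Hom P X) (q : Hom P Y),
    E _ _ f -> ExtOb E Y -> IsPullback f g p q -> E _ _ q;
  ext_exact : forall (K X B : C) (k : Hom K X) (f : Hom X B),
    ShortExact k f -> ExtOb E X -> ExtOb E K -> E _ _ f;
  ext_five : forall (K X B L Y : C) (kX : Hom K X) (f : Hom X B)
      (kY : Hom L Y) (g : Hom Y B) (k : Hom K L) (a : Hom X Y),
    ShortExact kX f -> ShortExact kY g -> a ∘ kX = kY ∘ k -> g ∘ a = f ->
    E _ _ f -> E _ _ k -> ExtOb E Y -> E _ _ a
}.

(** [E^1] as a class of morphisms of [Arr C]. *)
Definition DoubleExt (C : Category) (E : MorClass C) : MorClass (Arr C) :=
  fun (a b : ArrOb C) (f : ArrHom a b) =>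
    [/\ E _ _ (arr a), E _ _ (arr b), E _ _ (hdom f), E _ _ (hcod f)
      & exists (P : C) (p : Hom P (acod a)) (q : Hom P (adom b))
          (u : Hom (adom a) P),
          IsPullback (hcod f) (arr b) p q /\
          (p ∘ u = arr a /\ q ∘ u = hdom f) /\
          [/\ E _ _ p, E _ _ q & E _ _ u]].

Program Definition Powerset (n : nat) : Category := {|
  Ob := {set 'I_n};
  Hom := fun S T => S \subset T;
  idm := fun S => subxx S;
  comp := fun R S T hST hRS => subset_trans hRS hST
|}.
Next Obligation. by move=> *; apply: bool_irrelevance. Qed.
Next Obligation. by move=> *; apply: bool_irrelevance. Qed.
Next Obligation. by move=> *; apply: bool_irrelevance. Qed.

Definition NArr (n : nat) (C : Category) : Category := Fun (op (Powerset n)) C.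

(** [lift i] is the map [s_i] (it sends [k] to [k] if [k < i], to [k.+1]
    otherwise), so [low i S] is [S^i] and [high i S] is [S^i ∪ {i}].
    For [i = ord_max : 'I_n.+1], [lift i] is the inclusion of [{0, …, n.-1}] in
    [{0, …, n}], so [low ord_max S] is [S] and [high ord_max S] is [S ∪ {n}]. *)
Definition low n (i : 'I_n.+1) (S : {set 'I_n}) : {set 'I_n.+1} :=
  [set lift i k | k in S].
Definition high n (i : 'I_n.+1) (S : {set 'I_n}) : {set 'I_n.+1} :=
  i |: low i S.

Lemma low_mono n (i : 'I_n.+1) (S T : {set 'I_n}) :
  S \subset T -> low i S \subset low i T.
Proof. exact: imsetS. Qed.

Lemma high_mono n (i : 'I_n.+1) (S T : {set 'I_n}) :
  S \subset T -> high i S \subset high i T.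
Proof. by move=> h; apply: setUS; apply: low_mono. Qed.

Lemma low_high n (i : 'I_n.+1) (S : {set 'I_n}) : low i S \subset high i S.
Proof. exact: subsetUr. Qed.

Section HigherArrows.
Variables (C : Category) (n : nat).

(** [trans A h] is [a_S^T] for [h : S \subset T]. *)
Definition trans m (A : NArr m C) (S T : {set 'I_m}) (h : S \subset T) :
  Hom (fobj A T) (fobj A S) := @fmap _ _ A T S h.

Lemma trans_id m (A : NArr m C) (S : {set 'I_m}) (h : S \subset S) :
  trans A h = idm _.
Proof. by rewrite /trans (bool_irrelevance h (subxx S)); exact: (fmap_id A). Qed.

Lemma trans_comp m (A : NArr m C) (R S T : {set 'I_m}) (h1 : R \subset S)
    (h2 : S \subset T) (h : R \subset T) : trans A h1 ∘ trans A h2 = trans A h.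
Proof.
rewrite /trans (bool_irrelevance h (subset_trans h1 h2)).
by symmetry; exact: (fmap_comp A (X := T) (Y := S) (Z := R) h1 h2).
Qed.

Lemma trans_nat m (A B : NArr m C) (f : Hom A B) (S T : {set 'I_m})
    (h : S \subset T) : ntc f S ∘ trans A h = trans B h ∘ ntc f T.
Proof. exact: (nt_nat f (X := T) (Y := S) h). Qed.

Program Definition restr m (F : {set 'I_n} -> {set 'I_m})
    (F_mono : forall S T : {set 'I_n}, S \subset T -> F S \subset F T)
    (A : NArr m C) : NArr n C := {|
  fobj := fun S => fobj A (F S);
  fmap := fun T S (h : S \subset T) => trans A (F_mono S T h)
|}.
Next Obligation. by move=> *; exact: trans_id. Qed.
Next Obligation. by move=> *; symmetry; exact: trans_comp. Qed.

Program Definition delta (A : NArr n.+1 C) : Arr (NArr n C) := {|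
  adom := restr (@high_mono n ord_max) A;
  acod := restr (@low_mono n ord_max) A;
  arr := {| ntc := fun S => trans A (low_high ord_max S) |}
|}.
Next Obligation.
move=> A T S h /=; have hS : low ord_max S \subset high ord_max T.
  exact: subset_trans (low_high _ _) (high_mono _ h).
by rewrite !(trans_comp _ _ _ hS).
Qed.

Program Definition delta_hom (A B : NArr n.+1 C) (f : Hom A B) :
  Hom (delta A) (delta B) := {|
  hdom := {| ntc := fun S => ntc f (high ord_max S) |};
  hcod := {| ntc := fun S => ntc f (low ord_max S) |}
|}.
Next Obligation. by move=> A B f T S h; exact: (trans_nat f). Qed.
Next Obligation. by move=> A B f T S h; exact: (trans_nat f). Qed.
Next Obligation.
by move=> A B f; apply: nt_ext => S /=; symmetry; exact: (trans_nat f).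
Qed.

Program Definition rho (i : 'I_n.+1) (A : NArr n.+1 C) : NArr n (Arr C) := {|
  fobj := fun S => MkArr (trans A (low_high i S));
  fmap := fun T S (h : S \subset T) =>
    {| hdom := trans A (high_mono i h); hcod := trans A (low_mono i h) |}
|}.
Next Obligation.
move=> i A T S h /=; have hS : low i S \subset high i T.
  exact: subset_trans (low_high _ _) (high_mono _ h).
by rewrite !(trans_comp _ _ _ hS).
Qed.
Next Obligation. by move=> i A S; apply: arrhom_ext; exact: trans_id. Qed.
Next Obligation.
by move=> i A T S R h g; apply: arrhom_ext; symmetry; exact: trans_comp.
Qed.
End HigherArrows.

(** [HExt E n] is [E^n], a class of morphisms of [NArr n C]. For [n = 0] the
    category [NArr 0 C] is identified with [C] by evaluation at the empty set. *)
Fixpoint HExt (C : Category) (E : MorClass C) (n : nat) : MorClass (NArr n C) :=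
  match n return MorClass (NArr n C) with
  | 0 => fun A B f => E _ _ (ntc f set0)
  | m.+1 => fun A B f => DoubleExt (HExt E (n := m)) (delta_hom f)
  end.

Definition IsNFoldExt (C : Category) (E : MorClass C) (n : nat) :
    NArr n C -> Prop :=
  match n return NArr n C -> Prop with
  | 0 => fun A => ExtOb E (fobj A set0)
  | m.+1 => fun A => @HExt C E m _ _ (arr (delta A))
  end.

(* Main.v *)
From mathcomp Require Import all_boot zify.
From Stdlib Require Import IndefiniteDescription.
Require Import Defs.

(** Being a higher extension is a property of a cube which does not depend on
    the order in which its directions are listed. Both sides of the theorem test
    the same cube: the definition of an [n]-fold extension peels off the last
    direction first, while [rho i] makes direction [i] the innermost one. So the
    point is to move a direction past the others.

    The symmetry starts in dimension three. Call a square in a category with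
    pullbacks a double extension when its four sides and the comparison to the
    pullback are extensions. A square of arrows is then a double extension of
    double extensions exactly when the six faces of the resulting 3-cube are
    double extensions and the map from its initial vertex to the limit of the
    rest of the cube is an extension. This description is symmetric in the
    three directions; what has to be checked is that the limit of the punctured
    cube can be computed as a pullback of pullbacks in two different ways
    ([punctured_cube_limit], [triple_ext_swap]).

    Of the structure of a class of extensions, the argument uses that it
    contains the identities of its objects, is closed under composition and is
    stable under pullback ([StableClass]), in a category with pullbacks. These
    properties make the notion of double extension insensitive to the chosen
    pullback ([double_ext_iff]), and they pass from [F] to [DoubleExt F]
    ([double_ext_stable]), hence to every [HExt E n].

    The induction is [hext_rho]: a morphism of [n.+1]-fold arrows is in
    [E^(n+1)] if and only if [rho i] sends it into [(E^1)^n]. To compare, choose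
    the direction [j] which becomes the last one once [i] is removed. Taking the
    face in direction [j] commutes, up to isomorphism, with applying [rho]
    ([face_rho_cmp]), so the induction hypothesis reduces the claim to replacing
    the last direction by [j] in the definition of [E^(n+2)]. Either [j] is
    the last direction, or it is the last but one, and then the symmetry in
    dimension three applies ([face_direction]). *)

Set Implicit Arguments.
Unset Strict Implicit.
Unset Printing Implicit Defensive.
#[local] Obligation Tactic := idtac.
Local Open Scope cat_scope.

(** * Pullbacks *)

Section Pullbacks.
Variable C : Category.

Lemma pb_lift (X Y B P : C) (f : Hom X B) (g : Hom Y B) (p : Hom P X)
    (q : Hom P Y) (T : C) (x : Hom T X) (y : Hom T Y) :
  IsPullback f g p q -> f ∘ x = g ∘ y -> exists u, p ∘ u = x /\ q ∘ u = y.
Proof. by move=> [_ h] e; have [u [hu _]] := h T x y e; exists u. Qed.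

Lemma pb_monic (X Y B P : C) (f : Hom X B) (g : Hom Y B) (p : Hom P X)
    (q : Hom P Y) (T : C) (u v : Hom T P) :
  IsPullback f g p q -> p ∘ u = p ∘ v -> q ∘ u = q ∘ v -> u = v.
Proof.
move=> [e h] e1 e2.
have [|w [_ hw]] := h T (p ∘ v) (q ∘ v); first by rewrite !compA e.
by rewrite -(hw u) // -(hw v).
Qed.

Lemma pb_intro (X Y B P : C) (f : Hom X B) (g : Hom Y B) (p : Hom P X)
    (q : Hom P Y) :
  f ∘ p = g ∘ q ->
  (forall (T : C) (u v : Hom T P), p ∘ u = p ∘ v -> q ∘ u = q ∘ v -> u = v) ->
  (forall (T : C) (x : Hom T X) (y : Hom T Y), f ∘ x = g ∘ y ->
     exists u, p ∘ u = x /\ q ∘ u = y) ->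
  IsPullback f g p q.
Proof.
move=> e hm hl; split=> // T x y /hl [u [u1 u2]].
by exists u; split=> // v [v1 v2]; apply: hm; rewrite ?u1 ?u2 ?v1 ?v2.
Qed.

Lemma pb_sym (X Y B P : C) (f : Hom X B) (g : Hom Y B) (p : Hom P X)
    (q : Hom P Y) : IsPullback f g p q -> IsPullback g f q p.
Proof.
move=> h; apply: pb_intro => [|T u v e1 e2|T x y e]; first by case: h.
  exact: pb_monic h e2 e1.
by have [u [u1 u2]] := pb_lift h (esym e); exists u.
Qed.

Lemma pb_id (X Y : C) (g : Hom Y X) : IsPullback (idm X) g g (idm Y).
Proof.
apply: pb_intro => [|T u v _|T x y]; first by rewrite comp_idl comp_idr.
  by rewrite !comp_idl.
by rewrite comp_idl => ->; exists y; rewrite comp_idl.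
Qed.

Lemma pb_compare (X Y B P P' : C) (f : Hom X B) (g : Hom Y B) (p : Hom P X)
    (q : Hom P Y) (p' : Hom P' X) (q' : Hom P' Y) :
  IsPullback f g p q -> IsPullback f g p' q' ->
  exists t : Hom P' P, [/\ IsIso t, p ∘ t = p' & q ∘ t = q'].
Proof.
move=> h h'; have [t [t1 t2]] := pb_lift h (proj1 h').
have [s [s1 s2]] := pb_lift h' (proj1 h).
exists t; split=> //; exists s; split.
  by apply: (pb_monic h'); rewrite compA ?s1 ?s2 ?t1 ?t2 comp_idr.
by apply: (pb_monic h); rewrite compA ?t1 ?t2 ?s1 ?s2 comp_idr.
Qed.

Lemma pb_along_iso (X Y B P P' : C) (f : Hom X B) (g : Hom Y B) (p : Hom P X)
    (q : Hom P Y) (t : Hom P' P) :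
  IsPullback f g p q -> IsIso t -> IsPullback f g (p ∘ t) (q ∘ t).
Proof.
move=> h [s [st ts]]; apply: pb_intro => [|T u v e1 e2|T x y e].
- by rewrite !compA (proj1 h).
- have e : t ∘ u = t ∘ v by apply: (pb_monic h); rewrite !compA.
  by rewrite -(comp_idl u) -(comp_idl v) -st -!compA e.
have [u [u1 u2]] := pb_lift h e; exists (s ∘ u).
by rewrite -!compA (compA t) ts comp_idl.
Qed.

End Pullbacks.

Definition HasPullbacks (C : Category) : Prop :=
  forall (X Y B : C) (f : Hom X B) (g : Hom Y B),
    exists (P : C) (p : Hom P X) (q : Hom P Y), IsPullback f g p q.

Definition PreservesPullbacks (C D : Category) (G : Functor C D) : Prop :=
  forall (X Y B P : C) (f : Hom X B) (g : Hom Y B) (p : Hom P X) (q : Hom P Y),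
    IsPullback f g p q ->
    IsPullback (fmap G f) (fmap G g) (fmap G p) (fmap G q).

(** The shape [Some true -> None <- Some false], as a preorder: limits over it
    are pullbacks. *)
Section Cospan.

Definition cospan_le (x y : option bool) : bool := (x == y) || (y == None).

Program Definition Cospan : Category := {|
  Ob := option bool;
  Hom := fun x y => cospan_le x y
|}.
Next Obligation. by move=> x; rewrite /cospan_le eqxx. Qed.
Next Obligation. by case=> [[]|] [[]|] [[]|]. Qed.
Next Obligation. by move=> *; apply: bool_irrelevance. Qed.
Next Obligation. by move=> *; apply: bool_irrelevance. Qed.
Next Obligation. by move=> *; apply: bool_irrelevance. Qed.

Lemma cospan_finite : FiniteCategory Cospan.
Proof.
split.
  by exists [:: None; Some true; Some false] => -[[]|] /=; tauto.
move=> x y /=.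
have [h|h] : cospan_le x y \/ ~ cospan_le x y.
- by case: (cospan_le x y); [left | right].
- by exists [:: h] => h'; left; apply: bool_irrelevance.
by exists [::].
Qed.

Variables (C : Category) (X Y B : C) (f : Hom X B) (g : Hom Y B).

Definition cospan_ob (x : option bool) : C :=
  match x with None => B | Some true => X | Some false => Y end.

Definition cospan_map (x y : option bool) :
    cospan_le x y -> Hom (cospan_ob x) (cospan_ob y) :=
  match x, y with
  | None, None => fun _ => idm _
  | Some true, None => fun _ => f
  | Some false, None => fun _ => g
  | Some true, Some true => fun _ => idm _
  | Some false, Some false => fun _ => idm _
  | _, _ => fun h => False_rect _ (Bool.diff_false_true h)
  end.

Program Definition cospan_functor : Functor Cospan C :=
  {| fobj := cospan_ob; fmap := cospan_map |}.
Next Obligation. by case=> [[]|]. Qed.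
Next Obligation.
by case=> [[]|] [[]|] [[]|] //= h k; rewrite ?comp_idl ?comp_idr.
Qed.

Lemma pullback_exists : FinitelyComplete C ->
  exists (P : C) (p : Hom P X) (q : Hom P Y), IsPullback f g p q.
Proof.
move=> hC; have [L [c [hc hL]]] := hC _ cospan_functor cospan_finite.
have e1 := hc (Some true) None (isT : @Hom Cospan (Some true) None).
have e2 := hc (Some false) None (isT : @Hom Cospan (Some false) None).
exists L, (c (Some true)), (c (Some false)); rewrite /= in e1 e2.
apply: pb_intro => [|T u v k1 k2|T x y e]; first by rewrite e1 e2.
  have [|w [_ hw]] := hL T (fun j => c j ∘ v).
    by move=> j k h; rewrite compA hc.
  rewrite -(hw u) ?(hw v) //; case=> [[]|] //.
  by rewrite -e1 -!compA k1.
pose d j : Hom T (cospan_functor j) :=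
  match j with None => f ∘ x | Some true => x | Some false => y end.
have [|w [hw _]] := hL T d.
  by case=> [[]|] [[]|] h //=; rewrite ?comp_idl.
by exists w; split; [apply: (hw (Some true)) | apply: (hw (Some false))].
Qed.

End Cospan.

(** * Pullbacks and isomorphisms of arrows and of functors *)

Lemma arr_iso (C : Category) (a b : Arr C) (f : Hom a b) :
  IsIso (hdom f) -> IsIso (hcod f) -> IsIso f.
Proof.
move=> [s1 [s1f fs1]] [s0 [s0f fs0]].
have hs : a ∘ s1 = s0 ∘ b.
  rewrite -(comp_idl (a ∘ s1)) -s0f -compA (compA _ a) -(hcomm f).
  by rewrite -compA fs1 comp_idr.
by exists (MkArrHom hs); split; apply: arrhom_ext.
Qed.

Lemma arr_iso_components (C : Category) (a b : Arr C) (f : Hom a b) :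
  IsIso f -> IsIso (hdom f) /\ IsIso (hcod f).
Proof.
move=> [g [gf fg]]; split; [exists (hdom g) | exists (hcod g)]; split.
- exact: (congr1 (@hdom C a a) gf).
- exact: (congr1 (@hdom C b b) fg).
- exact: (congr1 (@hcod C a a) gf).
exact: (congr1 (@hcod C b b) fg).
Qed.

Section ArrPullbacks.
Variable C : Category.
Hypothesis hC : HasPullbacks C.

Lemma arr_pb (a b c d : Arr C) (f : Hom a c) (g : Hom b c) (p : Hom d a)
    (q : Hom d b) :
  IsPullback (hdom f) (hdom g) (hdom p) (hdom q) ->
  IsPullback (hcod f) (hcod g) (hcod p) (hcod q) -> IsPullback f g p q.
Proof.
move=> h1 h0; apply: pb_intro => [|t u v e1 e2|t x y e].
- by apply: arrhom_ext; [case: h1 | case: h0].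
- apply: arrhom_ext.
    by apply: (pb_monic h1); [have := congr1 (@hdom _ _ _) e1
                            | have := congr1 (@hdom _ _ _) e2].
  by apply: (pb_monic h0); [have := congr1 (@hcod _ _ _) e1
                          | have := congr1 (@hcod _ _ _) e2].
have [u1 [p1 q1]] := pb_lift h1 (congr1 (@hdom _ _ _) e).
have [u0 [p0 q0]] := pb_lift h0 (congr1 (@hcod _ _ _) e).
have hu : d ∘ u1 = u0 ∘ t.
  apply: (pb_monic h0); rewrite !compA.
    by rewrite p0 -(hcomm p) -compA p1 (hcomm x).
  by rewrite q0 -(hcomm q) -compA q1 (hcomm y).
by exists (MkArrHom hu); split; apply: arrhom_ext.
Qed.

Lemma arr_pb_exists (a b c : Arr C) (f : Hom a c) (g : Hom b c) :
  exists (d : Arr C) (p : Hom d a) (q : Hom d b),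
    IsPullback (hdom f) (hdom g) (hdom p) (hdom q) /\
    IsPullback (hcod f) (hcod g) (hcod p) (hcod q).
Proof.
have [P1 [p1 [q1 h1]]] := hC (hdom f) (hdom g).
have [P0 [p0 [q0 h0]]] := hC (hcod f) (hcod g).
have [|d [dp dq]] := pb_lift h0 (x := a ∘ p1) (y := b ∘ q1).
  by rewrite !compA -(hcomm f) -(hcomm g) -!compA (proj1 h1).
by exists (MkArr d), (@MkArrHom _ (MkArr d) a p1 p0 (esym dp)),
  (@MkArrHom _ (MkArr d) b q1 q0 (esym dq)).
Qed.

Lemma arr_has_pullbacks : HasPullbacks (Arr C).
Proof.
move=> a b c f g; have [d [p [q [h1 h0]]]] := arr_pb_exists f g.
by exists d, p, q; apply: arr_pb.
Qed.

(** Pullbacks are unique up to isomorphism, so that each of them inherits the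
    property of the one constructed componentwise. *)
Lemma arr_pb_components (a b c d : Arr C) (f : Hom a c) (g : Hom b c)
    (p : Hom d a) (q : Hom d b) :
  IsPullback f g p q ->
  IsPullback (hdom f) (hdom g) (hdom p) (hdom q) /\
  IsPullback (hcod f) (hcod g) (hcod p) (hcod q).
Proof.
move=> h; have [d' [p' [q' [h1 h0]]]] := arr_pb_exists f g.
have [t [/arr_iso_components [t1 t0] <- <-]] := pb_compare (arr_pb h1 h0) h.
by split; apply: pb_along_iso.
Qed.

End ArrPullbacks.

Section FunPullbacks.
Variables J C : Category.
Hypothesis hC : HasPullbacks C.

Lemma nt_iso (F G : Fun J C) (t : Hom F G) :
  (forall X, IsIso (ntc t X)) -> IsIso t.
Proof.
move=> h; pose s X := constructive_indefinite_description _ (h X).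
have hs X Y (f : Hom X Y) : sval (s Y) ∘ fmap G f = fmap F f ∘ sval (s X).
  case: (s X) (s Y) => [v [_ tv]] [w [wt _]] /=.
  rewrite -(comp_idr (fmap G f)) -tv (compA (fmap G f)) -nt_nat.
  by rewrite -compA compA wt comp_idl.
exists (Build_NatTrans hs); split; apply: nt_ext => X /=;
  by case: (s X) => w [].
Qed.

Lemma fun_pb (F G H P : Fun J C) (f : Hom F H) (g : Hom G H) (p : Hom P F)
    (q : Hom P G) :
  (forall X, IsPullback (ntc f X) (ntc g X) (ntc p X) (ntc q X)) ->
  IsPullback f g p q.
Proof.
move=> h; apply: pb_intro => [|T u v e1 e2|T x y e].
- by apply: nt_ext => X; case: (h X).
- apply: nt_ext => X; apply: (pb_monic (h X)).
    exact: (congr1 (fun t : NatTrans T F => ntc t X) e1).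
  exact: (congr1 (fun t : NatTrans T G => ntc t X) e2).
pose u X := constructive_indefinite_description _
  (pb_lift (h X) (congr1 (fun t : NatTrans T H => ntc t X) e)).
have hu X Y (k : Hom X Y) : sval (u Y) ∘ fmap T k = fmap P k ∘ sval (u X).
  case: (u X) (u Y) => [v [v1 v2]] [w [w1 w2]] /=.
  apply: (pb_monic (h Y)); rewrite !compA.
    by rewrite w1 !nt_nat -compA v1.
  by rewrite w2 !nt_nat -compA v2.
by exists (Build_NatTrans hu); split; apply: nt_ext => X /=;
  case: (u X) => v [].
Qed.

(** A pullback is chosen for every object; universality then makes the chosen
    vertices into a functor. *)
Lemma fun_pb_exists (F G H : Fun J C) (f : Hom F H) (g : Hom G H) :
  exists (P : Fun J C) (p : Hom P F) (q : Hom P G),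
    forall X, IsPullback (ntc f X) (ntc g X) (ntc p X) (ntc q X).
Proof.
pose sP X := constructive_indefinite_description _ (hC (ntc f X) (ntc g X)).
pose sp X := constructive_indefinite_description _ (svalP (sP X)).
pose sq X := constructive_indefinite_description _ (svalP (sp X)).
pose P X := sval (sP X); pose p X : Hom (P X) (F X) := sval (sp X).
pose q X : Hom (P X) (G X) := sval (sq X).
have h X : IsPullback (ntc f X) (ntc g X) (p X) (q X) := svalP (sq X).
have ex X Y (k : Hom X Y) : exists u : Hom (P X) (P Y),
    p Y ∘ u = fmap F k ∘ p X /\ q Y ∘ u = fmap G k ∘ q X.
  by apply: (pb_lift (h Y)); rewrite !compA !nt_nat -!compA (proj1 (h X)).
pose m X Y k := sval (constructive_indefinite_description _ (ex X Y k)).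
have m1 X Y k : p Y ∘ m X Y k = fmap F k ∘ p X.
  by rewrite /m; case: constructive_indefinite_description => ? [].
have m2 X Y k : q Y ∘ m X Y k = fmap G k ∘ q X.
  by rewrite /m; case: constructive_indefinite_description => ? [].
have mid X : m X X (idm X) = idm (P X).
  by apply: (pb_monic (h X)); rewrite ?m1 ?m2 fmap_id comp_idl comp_idr.
have mcomp X Y Z (l : Hom Y Z) (k : Hom X Y) :
    m X Z (l ∘ k) = m Y Z l ∘ m X Y k.
  apply: (pb_monic (h Z)); rewrite compA ?m1 ?m2 fmap_comp -!compA.
    by rewrite m1.
  by rewrite m2.
pose PF : Functor J C := Build_Functor mid mcomp.
exists PF, (@Build_NatTrans _ _ PF F p m1), (@Build_NatTrans _ _ PF G q m2).
exact: h.
Qed.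

Lemma fun_has_pullbacks : HasPullbacks (Fun J C).
Proof.
move=> F G H f g; have [P [p [q h]]] := fun_pb_exists f g.
by exists P, p, q; apply: fun_pb.
Qed.

(** As for [arr_pb_components]: comparison with the pointwise pullback. *)
Lemma fun_pb_components (F G H P : Fun J C) (f : Hom F H) (g : Hom G H)
    (p : Hom P F) (q : Hom P G) (X : J) :
  IsPullback f g p q -> IsPullback (ntc f X) (ntc g X) (ntc p X) (ntc q X).
Proof.
move=> h; have [P' [p' [q' h']]] := fun_pb_exists f g.
have [t [[s [st ts]] <- <-]] := pb_compare (fun_pb h') h.
apply: (pb_along_iso (h' X)); exists (ntc s X); split.
  exact: (congr1 (fun t : NatTrans P P => ntc t X) st).
exact: (congr1 (fun t : NatTrans P' P' => ntc t X) ts).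
Qed.

End FunPullbacks.

(** * Pullback-stable classes of morphisms *)

(** The part of the notion of class of extensions on which the symmetry of
    higher extensions rests. Pullback stability is restricted to base changes
    along morphisms from objects of [F^-], as for extensions; it implies that
    isomorphisms between objects of [F^-] are in [F]. *)
Record StableClass (C : Category) (F : MorClass C) : Prop := {
  stable_id : forall X : C, ExtOb F X -> F _ _ (idm X);
  stable_comp : forall (X Y Z : C) (f : Hom X Y) (g : Hom Y Z),
    F _ _ f -> F _ _ g -> F _ _ (g ∘ f);
  stable_pullback : forall (X B Y P : C) (f : Hom X B) (g : Hom Y B)
      (p : Hom P X) (q : Hom P Y),
    F _ _ f -> ExtOb F Y -> IsPullback f g p q -> F _ _ q
}.

Lemma ext_dom (C : Category) (F : MorClass C) (X Y : C) (f : Hom X Y) :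
  F _ _ f -> ExtOb F X.
Proof. by left; exists Y, f. Qed.

Lemma ext_cod (C : Category) (F : MorClass C) (X Y : C) (f : Hom X Y) :
  F _ _ f -> ExtOb F Y.
Proof. by right; exists X, f. Qed.

Lemma iso_inv (C : Category) (X Y : C) (f : Hom X Y) :
  IsIso f -> exists g : Hom Y X, [/\ IsIso g, g ∘ f = idm X & f ∘ g = idm Y].
Proof. by move=> [g [e1 e2]]; exists g; split=> //; exists f. Qed.

Lemma extensions_stable (C : Category) (E : MorClass C) :
  ClassOfExtensions E -> StableClass E.
Proof.
move=> hE; split; [|exact: ext_comp hE|exact: ext_pullback hE].
by move=> X hX; apply: (ext_split_epi hE) => //; exists (idm X); rewrite comp_idl.
Qed.

Lemma stable_preimage (C D : Category) (G : Functor C D) (F : MorClass C)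
    (F' : MorClass D) :
  PreservesPullbacks G ->
  (forall (X Y : C) (f : Hom X Y), F _ _ f <-> F' _ _ (fmap G f)) ->
  StableClass F' -> StableClass F.
Proof.
move=> hG hF hF'.
have ob X : ExtOb F X -> ExtOb F' (G X).
  by move=> [[Y [f /hF h]]|[Y [f /hF h]]]; [apply: ext_dom h|apply: ext_cod h].
split=> [X /ob h|X Y Z f g /hF hf /hF hg|X B Y P f g p q /hF hf /ob hY /hG hP].
- by apply/hF; rewrite fmap_id; apply: stable_id.
- by apply/hF; rewrite fmap_comp; apply: stable_comp.
by apply/hF; apply: stable_pullback hP.
Qed.

Section StableTheory.
Variables (C : Category) (F : MorClass C).
Hypothesis hF : StableClass F.

(** An isomorphism is a pullback of the identity of its codomain. *)
Lemma stable_iso_cod (X Y : C) (f : Hom X Y) :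
  IsIso f -> ExtOb F Y -> F f.
Proof.
move=> hf hY; apply: (stable_pullback hF (stable_id hF hY) hY (p := f)).
by rewrite -[f]comp_idl; apply: (pb_along_iso _ hf); apply: pb_id.
Qed.

Lemma stable_iso_dom (X Y : C) (f : Hom X Y) :
  IsIso f -> ExtOb F X -> F f.
Proof.
move=> hf hX; have [g [hg _ _]] := iso_inv hf.
exact: stable_iso_cod hf (ext_dom (stable_iso_cod hg hX)).
Qed.

Lemma stable_arr_iso (X Y X' Y' : C) (f : Hom X Y) (f' : Hom X' Y')
    (s : Hom X X') (t : Hom Y Y') :
  IsIso s -> IsIso t -> f' ∘ s = t ∘ f -> F f <-> F f'.
Proof.
move=> hs ht e.
have [s' [hs' _ ss']] := iso_inv hs; have [t' [ht' t't _]] := iso_inv ht.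
split=> h.
  have -> : f' = t ∘ f ∘ s' by rewrite -e -compA ss' comp_idr.
  apply: stable_comp => //.
    exact: stable_iso_cod hs' (ext_dom h).
  by apply: stable_comp => //; apply: stable_iso_dom ht (ext_cod h).
have -> : f = t' ∘ f' ∘ s by rewrite -compA e compA t't comp_idl.
apply: stable_comp => //.
  exact: stable_iso_cod hs (ext_dom h).
by apply: stable_comp => //; apply: stable_iso_dom ht' (ext_cod h).
Qed.

Lemma stable_pullback_l (X B Y P : C) (f : Hom X B) (g : Hom Y B) (p : Hom P X)
    (q : Hom P Y) :
  F g -> ExtOb F X -> IsPullback f g p q -> F p.
Proof. by move=> hg hX /pb_sym; apply: stable_pullback. Qed.

(** The comparison with any pullback may be used to recognise double
    extensions. The projections of that pullback are in [F] because they are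
    pullbacks of two of the sides. *)
Lemma double_ext_iff (a b : Arr C) (f : Hom a b) (P : C)
    (p : Hom P (acod a)) (q : Hom P (adom b)) (u : Hom (adom a) P) :
  IsPullback (hcod f) (arr b) p q -> p ∘ u = arr a -> q ∘ u = hdom f ->
  DoubleExt F f <->
  [/\ F (arr a), F (arr b), F (hdom f), F (hcod f) & F u].
Proof.
move=> h pu qu; split; last first.
  move=> [ha hb h1 h0 hu]; split=> //; exists P, p, q, u; do 3?split=> //.
    exact: stable_pullback_l hb (ext_dom h0) h.
  exact: stable_pullback h0 (ext_dom hb) h.
move=> [ha hb h1 h0 [P' [p' [q' [u' [h' [[pu' qu'] [hp hq hu']]]]]]]]; split=> //.
have [t [ht pt qt]] := pb_compare h h'.
have -> : u = t ∘ u'.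
  by apply: (pb_monic h); rewrite compA ?pt ?qt ?pu ?qu ?pu' ?qu'.
by apply: stable_comp => //; apply: stable_iso_dom ht (ext_cod hu').
Qed.

Lemma double_ext_ob (a : Arr C) : ExtOb (DoubleExt F) a -> F (arr a).
Proof. by move=> [[b [f []]]|[b [f []]]]. Qed.

Hypothesis hC : HasPullbacks C.

Lemma square_compare (a b : Arr C) (f : Hom a b) :
  exists (P : C) (p : Hom P (acod a)) (q : Hom P (adom b)) (u : Hom (adom a) P),
    [/\ IsPullback (hcod f) (arr b) p q, p ∘ u = arr a & q ∘ u = hdom f].
Proof.
have [P [p [q h]]] := hC (hcod f) (arr b).
have [u [u1 u2]] := pb_lift h (esym (hcomm f)).
by exists P, p, q, u.
Qed.

Lemma double_ext_id (a : Arr C) : F (arr a) -> DoubleExt F (idm a : Hom a a).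
Proof.
move=> ha; have [h1 h0] := (ext_dom ha, ext_cod ha).
apply/(@double_ext_iff _ _ _ _ (arr a) (idm _) (idm _)).
- exact: pb_id.
- exact: comp_idr.
- exact: comp_idr.
by split=> //=; apply: stable_id.
Qed.

(** The comparison [w] of the composite square is the comparison [u] of the
    first one followed by [t], which is a pullback of the comparison [v] of the
    second one. *)
Lemma double_ext_comp (a b c : Arr C) (f : Hom a b) (g : Hom b c) :
  DoubleExt F f -> DoubleExt F g -> DoubleExt F (g ∘ f).
Proof.
have [P [p [q [u [hP pu qu]]]]] := square_compare f.
have [Q [p' [q' [v [hQ pv qv]]]]] := square_compare g.
have [R [r [s [w [hR rw sw]]]]] := square_compare (g ∘ f).
move=> /(double_ext_iff hP pu qu) [ha hb f1 f0 hu].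
move=> /(double_ext_iff hQ pv qv) [_ hc g1 g0 hv].
have gf0 := stable_comp hF f0 g0; have gf1 := stable_comp hF f1 g1.
apply/(double_ext_iff hR rw sw); split=> //.
have [|k [k1 k2]] := pb_lift hQ (x := hcod f ∘ r) (y := s).
  by rewrite compA; case: hR.
have [|t [t1 t2]] := pb_lift hR (x := p) (y := hdom g ∘ q).
  by rewrite /= -compA (proj1 hP) !compA (hcomm g).
have hv' : IsPullback v k q t.
  apply: pb_intro => [|T x y e1 e2|T x y e].
  - apply: (pb_monic hQ); rewrite !compA.
      by rewrite pv k1 -(proj1 hP) -compA t1.
    by rewrite qv k2 t2.
  - by apply: (pb_monic hP); rewrite -?t1 // -!compA e2.
  have [|z [z1 z2]] := pb_lift hP (x := r ∘ y) (y := x).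
    by rewrite compA -k1 -compA -e compA pv.
  exists z; split=> //; apply: (pb_monic hR); rewrite compA ?t1 // t2.
  by rewrite -compA z2 -qv -compA e compA k2.
have -> : w = t ∘ u.
  apply: (pb_monic hR); rewrite compA ?t1 ?t2 ?rw ?pu // sw.
  by rewrite -compA qu.
apply: stable_comp => //; apply: stable_pullback hv' => //.
exact: ext_dom (stable_pullback_l hc (ext_dom gf0) hR).
Qed.

(** The comparison [w] of the pulled back square is a pullback of the
    comparison [u] of the given one. *)
Lemma double_ext_pullback (a b c d : Arr C) (f : Hom a b) (g : Hom c b)
    (x : Hom d a) (y : Hom d c) :
  DoubleExt F f -> F (arr c) -> IsPullback f g x y -> DoubleExt F y.
Proof.
have [P [p [q [u [hP pu qu]]]]] := square_compare f.
have [R [r [s [w [hR rw sw]]]]] := square_compare y.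
move=> /(double_ext_iff hP pu qu) [ha hb f1 f0 hu] hc.
move=> /(arr_pb_components hC) [hd1 hd0].
have y1 := stable_pullback hF f1 (ext_dom hc) hd1.
have y0 := stable_pullback hF f0 (ext_cod hc) hd0.
have hs := stable_pullback hF y0 (ext_dom hc) hR.
have hr := stable_pullback_l hc (ext_dom y0) hR.
have [|l [l1 l2]] := pb_lift hP (x := hcod x ∘ r) (y := hdom g ∘ s).
  by rewrite !compA (proj1 hd0) (hcomm g) -!compA (proj1 hR).
have hw : IsPullback u l (hdom x) w.
  apply: pb_intro => [|T v v' e1 e2|T v v' e].
  - apply: (pb_monic hP); rewrite !compA.
      by rewrite pu l1 (hcomm x) -compA rw.
    by rewrite qu l2 (proj1 hd1) -compA sw.
  - by apply: (pb_monic hd1); rewrite // -sw -!compA e2.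
  have [|z [z1 z2]] := pb_lift hd1 (x := v) (y := s ∘ v').
    by rewrite compA -l2 -compA -e compA qu.
  exists z; split=> //; apply: (pb_monic hR); rewrite compA ?sw // rw.
  apply: (pb_monic hd0); rewrite !compA.
    by rewrite -(hcomm x) -compA z1 -pu -compA e compA l1.
  by rewrite -(hcomm y) -compA z2 compA (proj1 hR).
have hw' := stable_pullback hF hu (ext_dom hs) hw.
apply/(double_ext_iff hR rw sw); split=> //.
by rewrite -rw; apply: stable_comp.
Qed.

Lemma double_ext_stable : StableClass (DoubleExt F).
Proof.
split=> [a /double_ext_ob|a b c f g|a b c d f g x y hf /double_ext_ob].
- exact: double_ext_id.
- exact: double_ext_comp.
exact: double_ext_pullback.
Qed.

End StableTheory.

(** * Symmetry of double and triple extensions *)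

(** The objects [X10], ..., [Y00] are the vertices of a 3-cube other than the
    initial vertex [X11]. Both pullbacks compute the limit of this punctured
    cube: that of [e'] and [d] through the pullbacks [Q1] and [Q0] of two
    parallel faces, and that of [e] and [c] through the pullbacks [P1] and [P0]
    of the faces in another direction. *)
Lemma punctured_cube_limit (C : Category)
    (X10 X01 X00 Y11 Y10 Y01 Y00 P1 P0 Q1 Q0 M : C)
    (x0 : Hom X01 X00) (x0' : Hom X10 X00) (y1 : Hom Y11 Y10)
    (y1' : Hom Y11 Y01) (y0 : Hom Y01 Y00) (y0' : Hom Y10 Y00)
    (f10 : Hom X10 Y10) (f01 : Hom X01 Y01) (f00 : Hom X00 Y00)
    (p1 : Hom P1 X01) (q1 : Hom P1 Y11) (p0 : Hom P0 X00) (q0 : Hom P0 Y10)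
    (r1 : Hom Q1 X10) (s1 : Hom Q1 Y11) (r0 : Hom Q0 X00) (s0 : Hom Q0 Y01)
    (c : Hom P1 P0) (d : Hom Q1 Q0) (e : Hom X10 P0) (e' : Hom X01 Q0)
    (m : Hom M X01) (m' : Hom M Q1) (k : Hom M P1) :
  IsPullback f01 y1' p1 q1 -> IsPullback f00 y0' p0 q0 ->
  IsPullback f10 y1 r1 s1 -> IsPullback f00 y0 r0 s0 ->
  p0 ∘ c = x0 ∘ p1 -> q0 ∘ c = y1 ∘ q1 ->
  r0 ∘ d = x0' ∘ r1 -> s0 ∘ d = y1' ∘ s1 ->
  p0 ∘ e = x0' -> q0 ∘ e = f10 -> r0 ∘ e' = x0 -> s0 ∘ e' = f01 ->
  IsPullback e' d m m' -> p1 ∘ k = m -> q1 ∘ k = s1 ∘ m' ->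
  IsPullback e c (r1 ∘ m') k.
Proof.
move=> hP1 hP0 hQ1 hQ0 pc qc rd sd pe qe re' se' hM pk qk.
apply: pb_intro => [|T u v e1 e2|T x y exy].
- apply: (pb_monic hP0); rewrite !compA.
    by rewrite pe pc -(compA x0) pk -re' -rd -!compA (proj1 hM).
  by rewrite qe qc (proj1 hQ1) -!compA qk.
- apply: (pb_monic hM); first by rewrite -pk -!compA e2.
  apply: (pb_monic hQ1); first by rewrite !compA.
  by rewrite !compA -qk -!compA e2.
have [|t [t1 t2]] := pb_lift hQ1 (x := x) (y := q1 ∘ y).
  by rewrite -qe compA -qc -!compA exy.
have [|z [z1 z2]] := pb_lift hM (x := p1 ∘ y) (y := t).
  apply: (pb_monic hQ0); rewrite !compA.
    by rewrite re' rd -(compA x0') t1 -pe -pc -!compA exy.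
  by rewrite se' sd -(compA y1') t2 (proj1 hP1) -compA.
exists z; split; first by rewrite -compA z2.
apply: (pb_monic hP1); rewrite compA ?pk ?qk //.
by rewrite -compA z2.
Qed.

Section Swap.
Variable C : Category.

(** The transposition of a square, viewed as an arrow between arrows. *)
Definition swap_ob (X : Arr (Arr C)) : Arr (Arr C) :=
  @MkArr (Arr C) (MkArr (hdom (arr X))) (MkArr (hcod (arr X)))
    (@MkArrHom C (MkArr (hdom (arr X))) (MkArr (hcod (arr X)))
       (arr (adom X)) (arr (acod X)) (esym (hcomm (arr X)))).

Definition swap_dom (X Y : Arr (Arr C)) (f : Hom X Y) :
  Hom (adom (swap_ob X)) (adom (swap_ob Y)) :=
  @MkArrHom C (adom (swap_ob X)) (adom (swap_ob Y))
    (hdom (hdom f)) (hdom (hcod f)) (congr1 (@hdom _ _ _) (hcomm f)).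

Definition swap_cod (X Y : Arr (Arr C)) (f : Hom X Y) :
  Hom (acod (swap_ob X)) (acod (swap_ob Y)) :=
  @MkArrHom C (acod (swap_ob X)) (acod (swap_ob Y))
    (hcod (hdom f)) (hcod (hcod f)) (congr1 (@hcod _ _ _) (hcomm f)).

Lemma swap_comm (X Y : Arr (Arr C)) (f : Hom X Y) :
  arr (swap_ob Y) ∘ swap_dom f = swap_cod f ∘ arr (swap_ob X).
Proof. by apply: arrhom_ext; rewrite /= hcomm. Qed.

Definition swap_hom (X Y : Arr (Arr C)) (f : Hom X Y) :
  Hom (swap_ob X) (swap_ob Y) := MkArrHom (swap_comm f).

(** The pullback in the definition of a double extension is symmetric. *)
Lemma double_ext_swap (F : MorClass C) (X : Arr (Arr C)) :
  HasPullbacks C -> StableClass F ->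
  DoubleExt F (arr X) <-> DoubleExt F (arr (swap_ob X)).
Proof.
move=> hC hF; have [P [p [q [u [hP pu qu]]]]] := square_compare hC (arr X).
rewrite (double_ext_iff hF hP pu qu).
rewrite (double_ext_iff hF (f := arr (swap_ob X)) (pb_sym hP) qu pu).
by split=> -[].
Qed.

(** [swap_ob (swap_ob X)] is [X] up to an isomorphism with identity components;
    for a stable class this replaces an equality of dependent records. *)
Lemma swap_homK (F : MorClass (Arr (Arr C))) (X Y : Arr (Arr C)) (f : Hom X Y) :
  StableClass F -> F _ _ (swap_hom (swap_hom f)) <-> F _ _ f.
Proof.
move=> hF.
have id_comm (Z : Arr (Arr C)) :
    exists t : Hom (swap_ob (swap_ob Z)) Z,
      [/\ hdom (hdom t) = idm _, hcod (hdom t) = idm _,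
          hdom (hcod t) = idm _ & hcod (hcod t) = idm _].
  pose t (a : Arr C) : Hom (MkArr (arr a) : Arr C) a :=
    @MkArrHom C (MkArr (arr a)) a (idm _) (idm _)
      (etrans (comp_idr _) (esym (comp_idl _))).
  have ht : arr Z ∘ t (adom Z) = t (acod Z) ∘ arr (swap_ob (swap_ob Z)).
    by apply: arrhom_ext; rewrite /= comp_idr comp_idl.
  by exists (@MkArrHom (Arr C) (swap_ob (swap_ob Z)) Z
    (t (adom Z)) (t (acod Z)) ht).
have idiso (Z : C) : IsIso (idm Z) by exists (idm Z); rewrite comp_idl.
have [s [s1 s2 s3 s4]] := id_comm X; have [t [t1 t2 t3 t4]] := id_comm Y.
apply: (stable_arr_iso hF (s := s) (t := t)).
- by do 2 apply: arr_iso; rewrite ?s1 ?s2 ?s3 ?s4.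
- by do 2 apply: arr_iso; rewrite ?t1 ?t2 ?t3 ?t4.
by do 2 apply: arrhom_ext;
  rewrite /= ?s1 ?s2 ?s3 ?s4 ?t1 ?t2 ?t3 ?t4 comp_idr comp_idl.
Qed.

(** The faces [X] and [Y] are transposed. The other two sides of [swap_hom f]
    are double extensions because their comparisons are the components of [u],
    and the components of [v] are in [F] because they are the comparisons of
    the sides [hdom f] and [hcod f]. What remains is the comparison [z] of [v]
    with the limit of the punctured cube, which is also the limit used to test
    [u]. *)
Lemma triple_ext_swap_imp (F : MorClass C) (X Y : Arr (Arr C)) (f : Hom X Y) :
  HasPullbacks C -> StableClass F ->
  DoubleExt (DoubleExt F) f -> DoubleExt (DoubleExt F) (swap_hom f).
Proof.
move=> hC hF; have hF1 := double_ext_stable hF hC.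
have hC1 := arr_has_pullbacks hC.
have [P [p [q [u [hP pu qu]]]]] := square_compare hC1 f.
have [Q [r [s [v [hQ rv sv]]]]] := square_compare hC1 (swap_hom f).
have [M [m [m' [z [hM mz m'z]]]]] := square_compare hC v.
move=> /(double_ext_iff hF1 hP pu qu) [hX hY f1 f0 hu].
have [hP1 hP0] := arr_pb_components hC hP.
have [hQ1 hQ0] := arr_pb_components hC hQ.
have du := congr1 (@hdom _ _ _) pu; have cu := congr1 (@hcod _ _ _) pu.
have du' := congr1 (@hdom _ _ _) qu; have cu' := congr1 (@hcod _ _ _) qu.
have dv := congr1 (@hdom _ _ _) rv; have cv := congr1 (@hcod _ _ _) rv.
have dv' := congr1 (@hdom _ _ _) sv; have cv' := congr1 (@hcod _ _ _) sv.
rewrite /= in du cu du' cu' dv cv dv' cv'.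
move/(double_ext_swap _ hC hF): (hX) => hXs.
move/(double_ext_swap _ hC hF): (hY) => hYs.
have [_ _ x1 x0 _] := hX; have [_ _ y1 y0 _] := hY.
have [_ _ u1 u0 _] := hu.
have [_ _ f11 f10 _] := f1; have [_ _ f01 f00 _] := f0.
have g1 : DoubleExt F (hdom (swap_hom f)).
  by apply/(double_ext_iff hF (f := hdom (swap_hom f)) hP1 du du').
have g0 : DoubleExt F (hcod (swap_hom f)).
  by apply/(double_ext_iff hF (f := hcod (swap_hom f)) hP0 cu cu').
apply/(double_ext_iff hF1 hQ rv sv); split=> //.
have [hQa _ _ _ _] := stable_pullback hF1 g0 (ext_dom hYs) hQ.
move/(double_ext_iff hF (f := hdom f) hQ1 dv dv'): (f1) => [_ _ _ _ hv1].
move/(double_ext_iff hF (f := hcod f) hQ0 cv cv'): (f0) => [_ _ _ _ hv0].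
apply/(double_ext_iff hF hM mz m'z); split=> //.
(* [k] is the second projection of [M] as a pullback of [hcod u] and [arr P]. *)
have [|k [k1 k2]] := pb_lift hP1 (x := m) (y := hdom s ∘ m').
  have /= es := hcomm s.
  by rewrite compA es -compA -(proj1 hM) compA cv'.
have hM' : IsPullback (hcod u) (arr P) (hdom r ∘ m') k.
  exact: (punctured_cube_limit hP1 hP0 hQ1 hQ0 (esym (hcomm p)) (esym (hcomm q))
    (esym (hcomm r)) (esym (hcomm s)) cu cu' cv cv' hM k1 k2).
have kz : k ∘ z = hdom u.
  apply: (pb_monic hP1); rewrite compA ?k1 ?k2.
    by rewrite mz du.
  by rewrite -compA m'z dv' du'.
have rz : (hdom r ∘ m') ∘ z = arr (adom X) by rewrite -compA m'z.
by move/(double_ext_iff hF hM' rz kz): hu => [].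
Qed.

(** A square of squares is a triple extension independently of which of the two
    inner directions is taken first. *)
Lemma triple_ext_swap (F : MorClass C) (X Y : Arr (Arr C)) (f : Hom X Y) :
  HasPullbacks C -> StableClass F ->
  DoubleExt (DoubleExt F) f <-> DoubleExt (DoubleExt F) (swap_hom f).
Proof.
move=> hC hF; split; first exact: triple_ext_swap_imp.
move/(triple_ext_swap_imp hC hF); apply: (proj1 (swap_homK f _)).
apply: double_ext_stable (arr_has_pullbacks hC).
exact: double_ext_stable.
Qed.
End Swap.

(** * Faces of cubes *)

Program Definition arr_functor (C D : Category) (G : Functor C D) :
    Functor (Arr C) (Arr D) := {|
  fobj := fun a : Arr C => MkArr (fmap G (arr a)) : Arr D;
  fmap := fun (a b : Arr C) (f : Hom a b) =>
    @MkArrHom D (MkArr (fmap G (arr a))) (MkArr (fmap G (arr b)))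
      (fmap G (hdom f)) (fmap G (hcod f)) _
|}.
Next Obligation. by move=> C D G a b f /=; rewrite -!fmap_comp hcomm. Qed.
Next Obligation. by move=> C D G a; apply: arrhom_ext; exact: fmap_id. Qed.
Next Obligation.
by move=> C D G a b c g f; apply: arrhom_ext; exact: fmap_comp.
Qed.

(** [G] carries the comparison morphism of a square to that of its image, and a
    double extension may be tested on the image of a pullback. *)
Lemma double_ext_transport (C D : Category) (G : Functor C D) (F : MorClass C)
    (F' : MorClass D) :
  HasPullbacks C -> PreservesPullbacks G -> StableClass F -> StableClass F' ->
  (forall (X Y : C) (f : Hom X Y), F _ _ f <-> F' _ _ (fmap G f)) ->
  forall (a b : Arr C) (f : Hom a b),
    DoubleExt F f <-> DoubleExt F' (fmap (arr_functor G) f).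
Proof.
move=> hC hG hF hF' e a b f.
have [P [p [q [u [hP pu qu]]]]] := square_compare hC f.
rewrite (double_ext_iff hF hP pu qu).
have pu' : fmap G p ∘ fmap G u = fmap G (arr a) by rewrite -fmap_comp pu.
have qu' : fmap G q ∘ fmap G u = fmap G (hdom f) by rewrite -fmap_comp qu.
rewrite (double_ext_iff hF' (f := fmap (arr_functor G) f)
  (hG _ _ _ _ _ _ _ _ hP) pu' qu').
by split=> -[? ? ? ? ?]; split; apply/e.
Qed.

Section Cubes.
Variable C : Category.

Program Definition eval0 : Functor (NArr 0 C) C := {|
  fobj := fun A : NArr 0 C => fobj A set0;
  fmap := fun (A B : NArr 0 C) (f : Hom A B) => ntc f set0
|}.
Next Obligation. by []. Qed.
Next Obligation. by []. Qed.

(** The source of all commutation squares below: there is at most one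
    transition morphism between two vertices of a cube. *)
Lemma cube_square m (A : Functor (op (Powerset m)) C)
    (T S S' R : op (Powerset m)) (h1 : Hom S R) (h2 : Hom T S)
    (k1 : Hom S' R) (k2 : Hom T S') :
  fmap A h1 ∘ fmap A h2 = fmap A k1 ∘ fmap A k2.
Proof. by rewrite -!fmap_comp; congr fmap; apply: bool_irrelevance. Qed.

Lemma trans_iso m (A : NArr m C) (S T : {set 'I_m}) (h : S \subset T) :
  S = T -> IsIso (trans A h).
Proof.
by move=> e; subst T; rewrite trans_id; exists (idm _); rewrite comp_idl.
Qed.

Variable n : nat.

(** [delta] with an arbitrary direction [j] in the place of the last one. *)
Program Definition face_functor (j : 'I_n.+1) :
    Functor (NArr n.+1 C) (Arr (NArr n C)) := {|
  fobj := fun A : NArr n.+1 C => @MkArr (NArr n C)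
    (restr (@high_mono n j) A) (restr (@low_mono n j) A)
    {| ntc := fun S => trans A (low_high j S) |};
  fmap := fun (A B : NArr n.+1 C) (f : Hom A B) => {|
    hdom := {| ntc := fun S => ntc f (high j S) |};
    hcod := {| ntc := fun S => ntc f (low j S) |} |}
|}.
Next Obligation. by move=> j A T S h /=; apply: cube_square. Qed.
Next Obligation. by move=> j A B f T S h; exact: (trans_nat f). Qed.
Next Obligation. by move=> j A B f T S h; exact: (trans_nat f). Qed.
Next Obligation.
by move=> j A B f; apply: nt_ext => S; symmetry; exact: (trans_nat f).
Qed.
Next Obligation. by move=> j A; apply: arrhom_ext; apply: nt_ext. Qed.
Next Obligation. by move=> *; apply: arrhom_ext; apply: nt_ext. Qed.

Program Definition rho_functor (i : 'I_n.+1) :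
    Functor (NArr n.+1 C) (NArr n (Arr C)) := {|
  fobj := fun A : NArr n.+1 C => rho i A : NArr n (Arr C);
  fmap := fun (A B : NArr n.+1 C) (f : Hom A B) => {|
    ntc := fun S => @MkArrHom C (fobj (rho i A) S) (fobj (rho i B) S)
      (ntc f (high i S)) (ntc f (low i S)) _ |}
|}.
Next Obligation.
by move=> i A B f S; symmetry; exact: (trans_nat f).
Qed.
Next Obligation.
by move=> i A B f T S h; apply: arrhom_ext; exact: (trans_nat f).
Qed.
Next Obligation. by move=> *; apply: nt_ext => S; apply: arrhom_ext. Qed.
Next Obligation. by move=> *; apply: nt_ext => S; apply: arrhom_ext. Qed.

Hypothesis hC : HasPullbacks C.

Lemma face_functor_pb (j : 'I_n.+1) : PreservesPullbacks (face_functor j).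
Proof.
move=> X Y B P f g p q h; apply: arr_pb; apply: fun_pb => S;
  exact: (fun_pb_components hC _ h).
Qed.

Lemma rho_functor_pb (i : 'I_n.+1) : PreservesPullbacks (rho_functor i).
Proof.
move=> X Y B P f g p q h; apply: fun_pb => S.
by apply: arr_pb; exact: (fun_pb_components hC _ h).
Qed.

End Cubes.

Lemma eval0_pb (C : Category) : HasPullbacks C -> PreservesPullbacks (eval0 C).
Proof. move=> hC X Y B P f g p q h; exact: (fun_pb_components hC _ h). Qed.

Lemma delta_face (C : Category) n (A : NArr n.+1 C) :
  delta A = face_functor C ord_max A.
Proof. by congr MkArr; apply: nt_ext. Qed.

Lemma hext_succ (C : Category) (E : MorClass C) n (A B : NArr n.+1 C)
    (f : Hom A B) :
  HExt E (n := n.+1) f <->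
  DoubleExt (HExt E (n := n)) (fmap (face_functor C ord_max) f).
Proof.
have eA : arr (delta A) = arr (face_functor C ord_max A) by apply: nt_ext.
have eB : arr (delta B) = arr (face_functor C ord_max B) by apply: nt_ext.
have e1 : hdom (delta_hom f) = hdom (fmap (face_functor C ord_max) f).
  by apply: nt_ext.
have e0 : hcod (delta_hom f) = hcod (fmap (face_functor C ord_max) f).
  by apply: nt_ext.
by rewrite /= /DoubleExt eA eB e1 e0.
Qed.

Lemma narr_has_pullbacks (C : Category) n :
  HasPullbacks C -> HasPullbacks (NArr n C).
Proof. exact: fun_has_pullbacks. Qed.

Lemma hext_stable (C : Category) (E : MorClass C) n :
  HasPullbacks C -> StableClass E -> StableClass (HExt E (n := n)).
Proof.
move=> hC hE; elim: n => [|n IH].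
  by apply: (stable_preimage (eval0_pb hC)) hE.
apply: (stable_preimage (face_functor_pb hC ord_max) (@hext_succ _ E n)).
exact: double_ext_stable IH (narr_has_pullbacks hC).
Qed.

(** * Removing two directions from a cube *)

Section Commutation.
Variables (n : nat) (i j : 'I_n.+2) (i' j' : 'I_n.+1).

(** [i] and [j] are distinct directions of an [n.+2]-cube; [j'] is the name of
    [j] once [i] is removed, and [i'] the name of [i] once [j] is removed. The
    last clause says that the order of removal does not change the names of the
    other directions. *)
Definition complementary : Prop :=
  [/\ lift i j' = j, lift j i' = i
    & forall k, lift i (lift j' k) = lift j (lift i' k)].

Hypothesis ij : complementary.

Lemma low_lowC (S : {set 'I_n}) : low i (low j' S) = low j (low i' S).
Proof.
by case: ij => _ _ e; rewrite /low -!imset_comp; apply: eq_imset => k /=.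
Qed.

Lemma low_highC (S : {set 'I_n}) : low i (high j' S) = high j (low i' S).
Proof. by case: (ij) => e _ _; rewrite /high -low_lowC /low imsetU1 e. Qed.

Lemma high_lowC (S : {set 'I_n}) : high i (low j' S) = low j (high i' S).
Proof. by case: (ij) => _ e _; rewrite /high low_lowC /low imsetU1 e. Qed.

Lemma high_highC (S : {set 'I_n}) : high i (high j' S) = high j (high i' S).
Proof.
transitivity (i |: (j |: low j (low i' S))).
  by rewrite -/(high j _) -low_highC.
by rewrite setUCA -low_lowC -/(high i _) high_lowC.
Qed.
End Commutation.

Lemma complementary_exists n (i : 'I_n.+2) (j' : 'I_n.+1) :
  exists i' : 'I_n.+1, complementary i (lift i j') i' j'.
Proof.
have ne : lift i j' != i by rewrite eq_sym neq_lift.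
have [i' ei _] := unlift_some ne.
exists i'; split=> // k; apply: val_inj.
have /= := congr1 val ei; rewrite /bump; lia.
Qed.

(** The direction [j] which becomes the last one when [i] is removed is the
    last direction, unless [i] itself is the last one, in which case [j] is the
    last but one. *)
Lemma complementary_max n (i : 'I_n.+2) : exists (j : 'I_n.+2) (i' : 'I_n.+1),
  complementary i j i' ord_max /\
  (j = ord_max \/ i = ord_max /\ i' = ord_max).
Proof.
have [i' hi] := complementary_exists i ord_max.
exists (lift i ord_max), i'; split=> //.
case: hi => _ hi _; have /= := congr1 val hi; rewrite /= /bump => e.
have [ei|ei] := eqVneq i ord_max; [right|left]; last first.
  apply: val_inj => /=; rewrite /bump.
  have : val i != n.+1 by apply: contra ei => /eqP e'; apply/eqP/val_inj.
  by have := ltn_ord i; move=> /=; lia.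
split=> //; apply: val_inj => /=.
by move: e; rewrite ei /= /bump; have := ltn_ord i'; lia.
Qed.

Ltac cube_naturality := rewrite /= /trans /=; apply: cube_square.

Section Comparison.
Variables (C : Category) (n : nat) (i j : 'I_n.+2) (i' j' : 'I_n.+1).
Hypothesis ij : complementary i j i' j'.

Lemma eq_subset m (S T : {set 'I_m}) : S = T -> S \subset T.
Proof. by move=> ->. Qed.

(** Both sides put direction [i] inside and direction [j] outside. Their
    vertices are indexed by sets which are only provably equal, so they are
    compared by an isomorphism made of transition morphisms. *)
Program Definition face_rho_cmp (A : NArr n.+2 C) :
    @Hom (Arr (NArr n (Arr C)))
      (face_functor (Arr C) j' (rho_functor C i A))
      (arr_functor (rho_functor C i') (face_functor C j A)) := {|
  hdom := {| ntc := fun S => {|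
    hdom := trans A (eq_subset (esym (high_highC ij S)));
    hcod := trans A (eq_subset (esym (low_highC ij S))) |} |};
  hcod := {| ntc := fun S => {|
    hdom := trans A (eq_subset (esym (high_lowC ij S)));
    hcod := trans A (eq_subset (esym (low_lowC ij S))) |} |}
|}.
Next Obligation. by move=> A S; apply: cube_square. Qed.
Next Obligation. by move=> A T S h; apply: arrhom_ext; apply: cube_square. Qed.
Next Obligation. by move=> A S; apply: cube_square. Qed.
Next Obligation. by move=> A T S h; apply: arrhom_ext; apply: cube_square. Qed.
Next Obligation.
by move=> A; apply: nt_ext => S; apply: arrhom_ext; apply: cube_square.
Qed.

Lemma face_rho_cmp_iso A : IsIso (face_rho_cmp A).
Proof.
apply: arr_iso; apply: nt_iso => S; apply: arr_iso; apply: trans_iso; symmetry.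
- exact: high_highC.
- exact: low_highC.
- exact: high_lowC.
- exact: low_lowC.
Qed.

Lemma face_rho_cmp_nat (A B : NArr n.+2 C) (f : Hom A B) :
  fmap (arr_functor (rho_functor C i')) (fmap (face_functor C j) f)
    ∘ face_rho_cmp A =
  face_rho_cmp B ∘ fmap (face_functor (Arr C) j') (fmap (rho_functor C i) f).
Proof.
by apply: arrhom_ext; apply: nt_ext => S; apply: arrhom_ext; exact: trans_nat.
Qed.

(** Taking faces in two directions in the two possible orders gives transposed
    squares; this is how the order of the directions becomes a transposition. *)
Program Definition face_face_cmp (A : NArr n.+2 C) :
    @Hom (Arr (Arr (NArr n C)))
      (arr_functor (face_functor C i') (face_functor C j A))
      (swap_ob (arr_functor (face_functor C j') (face_functor C i A))) := {|
  hdom := {|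
    hdom := {| ntc := fun S => trans A (eq_subset (high_highC ij S)) |};
    hcod := {| ntc := fun S => trans A (eq_subset (low_highC ij S)) |} |};
  hcod := {|
    hdom := {| ntc := fun S => trans A (eq_subset (high_lowC ij S)) |};
    hcod := {| ntc := fun S => trans A (eq_subset (low_lowC ij S)) |} |}
|}.
Next Obligation. by move=> A T S h; cube_naturality. Qed.
Next Obligation. by move=> A T S h; cube_naturality. Qed.
Next Obligation. by move=> A; apply: nt_ext => S; cube_naturality. Qed.
Next Obligation. by move=> A T S h; cube_naturality. Qed.
Next Obligation. by move=> A T S h; cube_naturality. Qed.
Next Obligation. by move=> A; apply: nt_ext => S; cube_naturality. Qed.
Next Obligation.
by move=> A; apply: arrhom_ext; apply: nt_ext => S; cube_naturality.
Qed.

Lemma face_face_cmp_iso A : IsIso (face_face_cmp A).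
Proof.
apply: arr_iso; apply: arr_iso; apply: nt_iso => S /=; apply: trans_iso.
- exact: high_highC.
- exact: low_highC.
- exact: high_lowC.
- exact: low_lowC.
Qed.

Lemma face_face_cmp_nat (A B : NArr n.+2 C) (f : Hom A B) :
  swap_hom (fmap (arr_functor (face_functor C j')) (fmap (face_functor C i) f))
    ∘ face_face_cmp A =
  face_face_cmp B
    ∘ fmap (arr_functor (face_functor C i')) (fmap (face_functor C j) f).
Proof.
by do 2 apply: arrhom_ext; apply: nt_ext => S /=; exact: trans_nat.
Qed.

End Comparison.

(** * Higher extensions in a chosen direction *)

Section HigherExtensions.
Variables (C : Category) (E : MorClass C).
Hypotheses (hC : HasPullbacks C) (hE : StableClass E).

Let hN n := @narr_has_pullbacks C n hC.
Let hH n := @hext_stable C E n hC hE.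

(** The recursion defining higher extensions may peel off the direction [j]
    given by [complementary_max] instead of the last one. If these differ, then
    [j] is the last but one direction, and the two recursions differ by the
    transposition of the two inner directions of a triple extension. *)
Lemma face_direction n (i j : 'I_n.+2) (i' : 'I_n.+1)
    (A B : NArr n.+2 C) (f : Hom A B) :
  complementary i j i' ord_max ->
  (j = ord_max \/ i = ord_max /\ i' = ord_max) ->
  DoubleExt (HExt E (n := n.+1)) (fmap (face_functor C j) f) <->
  HExt E (n := n.+2) f.
Proof.
move=> hij ends; rewrite hext_succ.
case: ends hij => [-> //|[-> ->] hij].
have hD := double_ext_stable (hH n) (@hN n).
have tr := double_ext_transport (@hN n.+1)
  (face_functor_pb hC (n := n) ord_max) (hH n.+1) hD (@hext_succ _ E n).
rewrite !tr (triple_ext_swap (fmap _ (fmap (face_functor C ord_max) f)) (@hN n)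
  (hH n)).
have hDD := double_ext_stable hD (arr_has_pullbacks (@hN n)).
exact: (stable_arr_iso hDD (face_face_cmp_iso hij A) (face_face_cmp_iso hij B)
  (face_face_cmp_nat hij f)).
Qed.

(** In dimension 1 both sides are the same double extension in [C]. In the
    induction step the outermost direction of [rho i] corresponds to the
    direction [j] of the original cube. *)
Lemma hext_rho n (i : 'I_n.+1) (A B : NArr n.+1 C) (f : Hom A B) :
  HExt E (n := n.+1) f <->
  HExt (DoubleExt E) (n := n) (fmap (rho_functor C i) f).
Proof.
have hC1 := arr_has_pullbacks hC; have hE1 := double_ext_stable hE hC.
elim: n i A B f => [|n IH] i A B f.
  rewrite hext_succ (ord1 i) -(ord1 ord_max).
  have hE0 := hext_stable 0 hC hE.
  exact: (double_ext_transport (@narr_has_pullbacks C 0 hC) (eval0_pb hC)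
    hE0 hE).
have [j [i' [hij ends]]] := complementary_max i.
rewrite -(face_direction f hij ends) hext_succ.
have hS := hext_stable n.+1 hC hE; have hS1 := hext_stable n hC1 hE1.
rewrite (double_ext_transport (@narr_has_pullbacks C n.+1 hC)
  (rho_functor_pb hC i') hS hS1 (IH i')).
have hD := double_ext_stable hS1 (@narr_has_pullbacks _ n hC1).
symmetry; exact: (stable_arr_iso hD (face_rho_cmp_iso hij A)
  (face_rho_cmp_iso hij B) (face_rho_cmp_nat hij f)).
Qed.
End HigherExtensions.

Theorem theorem4p4 (C : Category) (E : MorClass C)
  (hC : SemiAbelian C) (hE : ClassOfExtensions E)
  (n : nat) (i : 'I_n.+1) (A : NArr n.+1 C) :
  IsNFoldExt E A <-> IsNFoldExt (DoubleExt E) (rho i A).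
Proof.
have {}hC : HasPullbacks C.
  by case: hC => _ hlim _ _ _ X Y B f g; apply: pullback_exists.
move/extensions_stable: hE => hE.
have hE1 := double_ext_stable hE hC; have hC1 := arr_has_pullbacks hC.
case: n i A => [|n] i A.
  have hA : IsNFoldExt E A <-> E _ _ (arr (fobj (rho i A) set0)).
    by rewrite (ord1 i) -(ord1 ord_max).
  (* An arrow in [E] is the domain of its identity, a double extension. *)
  rewrite hA; split=> [h|]; last exact: double_ext_ob.
  exact: ext_dom (double_ext_id hE h).
have [j [i' [hij ends]]] := complementary_max i.
have hS := hext_stable n hC hE; have hS1 := hext_stable n hC1 hE1.
transitivity (HExt E (n := n.+1) (arr (face_functor C j A))); last first.
  rewrite (hext_rho hC hE i').
  rewrite [X in _ <-> X]/IsNFoldExt delta_face.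
  have [h1 h0] := arr_iso_components (face_rho_cmp_iso hij A).
  exact: iff_sym (stable_arr_iso hS1 h1 h0 (hcomm (face_rho_cmp hij A))).
rewrite /IsNFoldExt delta_face.
case: ends hij => [-> //|[-> ->] hij].
(* Here [i] is the last direction and [j] the last but one. *)
rewrite !hext_succ.
have hN := @narr_has_pullbacks C n hC; have hD := double_ext_stable hS hN.
have [h1 h0] := arr_iso_components (face_face_cmp_iso hij A).
apply: (iff_trans (double_ext_swap
  (arr_functor (face_functor C ord_max) (face_functor C ord_max A)) hN hS)).
exact: iff_sym (stable_arr_iso hD h1 h0 (hcomm (face_face_cmp hij A))).
Qed.
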